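(* Let $(L_k)_{k\in\mathbb{Z}/24}$ be a non-degenerate configuration $\mathbb{B}_{24}$ over $\mathbb{C}$ whose triple points satisfy $P_{\{0,5,19\}}=(1:0:0)$, $P_{\{3,8,13\}}=(0:1:0)$, $P_{\{11,16,21\}}=(0:0:1)$, $P_{\{0,8,16\}}=(1:1:1)$, $P_{\{0,3,21\}}=(a:1:1)$ and $P_{\{0,10,14\}}=(b:1:1)$ with $a,b\in\mathbb{C}$, $a\neq 0$. Then $$\begin{aligned}& a^8b^3+a^7b^3+a^6b^4-6a^7b^2+3a^6b^3-6a^6b^2-2a^5b^3+10a^6b-6a^5b^2-2a^4b^3-a^6\\&+12a^5b+3a^4b^2-2a^3b^3-6a^5+3a^4b+6a^3b^2-a^2b^3-3a^4-13a^3b+9a^2b^2-ab^3\\&+4a^3-12a^2b+6ab^2-b^3+5a^2-3ab+2a-b=0.\end{aligned}$$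
   Context: A (non-degenerate) configuration $\mathbb{B}_n$ over a field $K$ is a configuration of $n$ lines with the incidences of the original Böröczky configuration of $n$ lines, with all lines and all triple points distinct: i.e. a family $(L_k)_{k\in\mathbb{Z}/n}$ of pairwise distinct lines in $\mathbb{P}^2(K)$ such that for every set $\{i,j,k\}$ of three distinct elements of $\mathbb{Z}/n$ with $i+j+k=0$ the lines $L_i,L_j,L_k$ have a common point $P_{\{i,j,k\}}$, and the points $P_{\{i,j,k\}}$, for different such sets, are pairwise distinct. For $n=24$ there are 85 such sets. (The original Böröczky configuration consists of the lines $L_k=Q_\alpha Q_{\pi-2\alpha}$, $\alpha=2k\pi/n$, where $Q_\alpha$ is the point obtained by rotating a fixed point of a circle by $\alpha$ about the center.) *)

(* Defs.v *)
From mathcomp Require Import all_boot all_order all_algebra.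
From mathcomp Require Import reals complex.
Set Implicit Arguments.
Unset Strict Implicit.
Unset Printing Implicit Defensive.
Import GRing.Theory.
Local Open Scope ring_scope.

(* The projective plane P^2(K): its points and lines are the subspaces of K^3
   of dimension 1 and 2, incidence is inclusion. *)
Record proj_point (K : fieldType) := ProjPoint {
  point_space :> {vspace 'rV[K]_3};
  point_dim : \dim point_space == 1%N }.

Record proj_line (K : fieldType) := ProjLine {
  line_space :> {vspace 'rV[K]_3};
  line_dim : \dim line_space == 2%N }.

Definition incident (K : fieldType) (P : proj_point K) (L : proj_line K) : bool :=
  (P <= L)%VS.

(* P = (x : y : z); it follows that x, y and z are not all zero. *)
Definition has_coords (K : fieldType) (P : proj_point K) (x y z : K) : Prop :=
  point_space P = <[\row_(i < 3) [:: x; y; z]`_i]>%VS.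

(* The sets {i, j, k} of three distinct elements of Z/n with i + j + k = 0.
   As 'Z_n is Z/2 for n < 2, this is meant for n > 1. *)
Definition zero_triples (n : nat) : {set {set 'Z_n}} :=
  [set I : {set 'Z_n} | (#|I| == 3) && (\sum_(i in I) i == 0)].

(* A non-degenerate configuration B_n over K. Only the values of P on
   zero_triples n matter; they are determined by L, whose lines are distinct. *)
Record Boroczky_config (n : nat) (K : fieldType)
    (L : 'Z_n -> proj_line K) (P : {set 'Z_n} -> proj_point K) : Prop := {
  Boroczky_lines_distinct : injective L;
  Boroczky_incidence : forall (I : {set 'Z_n}) (i : 'Z_n),
    I \in zero_triples n -> i \in I -> incident (P I) (L i);
  Boroczky_points_distinct : {in zero_triples n &, injective P} }.

(* Main.v *)
(* A line through two distinct points has the cross product of their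
   coordinates as its equation, and dually for the intersection of two lines.
   Both stay valid after division by a common factor c of the three entries:
   non-degeneracy makes the cross product nonzero, hence c is nonzero without
   any separate discussion of a and b. Starting from the six given points, all
   lines L_k with k in {0, 1, 2, 3, 5, ..., 11, 13, 14, 16, 19, 20, 21} are
   thus obtained as polynomial expressions in a and b. The triple {1, 3, 20}
   is not used in their construction, and the concurrency of L_1, L_3 and L_20
   says that a times the polynomial of the theorem vanishes. *)

Require Import Defs.
From mathcomp Require Import all_boot all_order all_algebra.
From mathcomp Require Import reals complex.
From mathcomp Require Import ring.
Set Implicit Arguments.
Unset Strict Implicit.
Unset Printing Implicit Defensive.
Import GRing.Theory.
Local Open Scope ring_scope.

(** * Row vectors of length 3 through their coordinates *)

Definition vec3 (K : fieldType) (x y z : K) : 'rV[K]_3 :=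
  \row_(i < 3) [:: x; y; z]`_i.

Lemma vec3_eta (K : fieldType) (v : 'rV[K]_3) :
  exists x y z, v = vec3 x y z.
Proof.
exists (v 0 0), (v 0 1), (v 0 2%:R); apply/rowP=> i; rewrite mxE.
by case: i => [[|[|[|//]]] lt_i3] /=; congr (v _ _); apply/val_inj.
Qed.

Lemma vec3D (K : fieldType) (x y z x' y' z' : K) :
  vec3 x y z + vec3 x' y' z' = vec3 (x + x') (y + y') (z + z').
Proof. by apply/rowP=> -[[|[|[|//]]] lt_i3]; rewrite !mxE. Qed.

Lemma vec3Z (K : fieldType) (c x y z : K) :
  c *: vec3 x y z = vec3 (c * x) (c * y) (c * z).
Proof. by apply/rowP=> -[[|[|[|//]]] lt_i3]; rewrite !mxE. Qed.

Lemma vec3_inj (K : fieldType) (x y z x' y' z' : K) :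
  vec3 x y z = vec3 x' y' z' -> [/\ x = x', y = y' & z = z'].
Proof.
move=> /rowP eq_v.
by have := (eq_v 0, eq_v 1, eq_v 2%:R); rewrite !mxE /= => -[[-> ->] ->].
Qed.

Lemma vec3_eq0 (K : fieldType) (x y z : K) :
  (vec3 x y z == 0) = [&& x == 0, y == 0 & z == 0].
Proof.
apply/eqP/and3P=> [/rowP v0|[/eqP-> /eqP-> /eqP->]].
  by have := (v0 0, v0 1, v0 2%:R); rewrite !mxE /= => -[[-> ->] ->].
by apply/rowP=> -[[|[|[|//]]] lt_i3]; rewrite !mxE.
Qed.

(** The factor is the quotient of the two entries at a position where the first vector is nonzero.
    The second vector may be zero, so [c] may be zero as well. *)
Lemma cross_eq0_proportional (K : fieldType) (x y z x' y' z' : K) :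
  vec3 x y z != 0 ->
  y * z' - z * y' = 0 -> z * x' - x * z' = 0 -> x * y' - y * x' = 0 ->
  exists c, vec3 x' y' z' = c *: vec3 x y z.
Proof.
move=> nz_v /subr0_eq e1 /subr0_eq e2 /subr0_eq e3.
have [x0|nz_x] := eqVneq x 0; last first.
  exists (x' / x); rewrite vec3Z; congr vec3; first by rewrite divfK.
    by apply: (mulfI nz_x); rewrite e3; field.
  by apply: (mulfI nz_x); rewrite -e2; field.
have [y0|nz_y] := eqVneq y 0; last first.
  exists (y' / y); rewrite vec3Z; congr vec3; last 1 first.
  - by apply: (mulfI nz_y); rewrite e1; field.
  - by apply: (mulfI nz_y); rewrite -e3; field.
  - by rewrite divfK.
have nz_z : z != 0 by move: nz_v; rewrite vec3_eq0 x0 y0 eqxx.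
exists (z' / z); rewrite vec3Z; congr vec3.
- by apply: (mulfI nz_z); rewrite e2; field.
- by apply: (mulfI nz_z); rewrite -e1; field.
- by rewrite divfK.
Qed.

(** * Homogeneous coordinates of points and equations of lines *)

Lemma dim_addv_line (K : fieldType) (vT : vectType K) (U : {vspace vT}) (v : vT) :
  v \notin U -> (\dim U < \dim (U + <[v]>))%N.
Proof.
move=> vU; rewrite ltn_neqAle dimvS ?addvSl // andbT.
apply: contra vU => /eqP dimU; rewrite memvE.
suff -> : U = (U + <[v]>)%VS by apply: addvSr.
by apply/eqP; rewrite eqEdim addvSl dimU leqnn.
Qed.

(** One inclusion suffices: a nonzero linear form has a kernel of dimension 2, so a line inside the
    kernel is equal to it. [mem_line_equation] supplies the converse. *)
Definition has_equation (K : fieldType) (L : proj_line K) (u v w : K) : Prop :=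
  vec3 u v w != 0 /\
  forall x y z, vec3 x y z \in line_space L -> u * x + v * y + w * z = 0.

Lemma has_coords_neq0 (K : fieldType) (P : proj_point K) (x y z : K) :
  has_coords P x y z -> vec3 x y z != 0.
Proof.
(* The dimension of a span [<[v]>] is the truth value of [v != 0] read as a number. *)
move=> hP; have := point_dim P; rewrite hP dim_vline.
by rewrite -/(vec3 x y z) eqb1.
Qed.

Lemma incident_coords (K : fieldType) (P : proj_point K) (L : proj_line K)
    (x y z : K) :
  has_coords P x y z -> incident P L = (vec3 x y z \in line_space L).
Proof. by rewrite /incident => ->; rewrite memvE. Qed.

Lemma proj_point_ext (K : fieldType) (P Q : proj_point K) :
  point_space P = point_space Q -> P = Q.
Proof.
case: P Q => [U dU] [V dV] /= eqUV; case: V / eqUV dV => dV.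
by congr ProjPoint; apply: bool_irrelevance.
Qed.

Lemma proj_line_ext (K : fieldType) (L M : proj_line K) :
  line_space L = line_space M -> L = M.
Proof.
case: L M => [U dU] [V dV] /= eqUV; case: V / eqUV dV => dV.
by congr ProjLine; apply: bool_irrelevance.
Qed.

Lemma proj_point_coords (K : fieldType) (P : proj_point K) :
  exists x y z, has_coords P x y z.
Proof.
have dP := point_dim P; set p := vpick (point_space P).
have [x [y [z def_p]]] := vec3_eta p; exists x, y, z.
have nz_p : p != 0 by rewrite vpick0 -dimv_eq0 (eqP dP).
apply/esym/eqP; rewrite -/(vec3 x y z) -def_p eqEdim dim_vline nz_p (eqP dP) andbT.
by rewrite -memvE memv_pick.
Qed.

Lemma has_coords_line (K : fieldType) (P : proj_point K) (x y z x' y' z' : K) :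
  has_coords P x y z -> vec3 x' y' z' \in <[vec3 x y z]>%VS ->
  vec3 x' y' z' != 0 -> has_coords P x' y' z'.
Proof.
move=> hP v'P nz_v'; apply/esym/eqP; rewrite -/(vec3 x' y' z') eqEdim hP.
by rewrite -memvE v'P !dim_vline -!/(vec3 _ _ _) nz_v' leq_b1.
Qed.

(** That [c] is nonzero is a conclusion here: the coordinates of a point are never all zero. *)
Lemma has_coordsZ (K : fieldType) (P : proj_point K) (c x y z : K) :
  has_coords P (c * x) (c * y) (c * z) -> has_coords P x y z.
Proof.
move=> hP; have := has_coords_neq0 hP; rewrite -vec3Z scaler_eq0 negb_or.
case/andP=> nz_c nz_v; apply: has_coords_line hP _ nz_v.
by apply/vlineP; exists c^-1; rewrite -vec3Z scalerK.
Qed.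

Lemma has_equationZ (K : fieldType) (L : proj_line K) (c u v w : K) :
  has_equation L (c * u) (c * v) (c * w) -> has_equation L u v w.
Proof.
case; rewrite -vec3Z scaler_eq0 negb_or => /andP[nz_c nz_n] eqL.
split=> // x y z /eqL; rewrite -!mulrA -!mulrDr => /eqP.
by rewrite mulf_eq0 (negPf nz_c) => /eqP.
Qed.

Lemma mem_line_equation (K : fieldType) (L : proj_line K) (u v w x y z : K) :
  has_equation L u v w ->
  (vec3 x y z \in line_space L) = (u * x + v * y + w * z == 0).
Proof.
case=> nz_n eqL; apply/idP/eqP=> [/eqL // | p0]; apply: contraNT nz_n => pL.
(* A vector off [L] would span the whole space together with [L]; if the form vanished on it too, it
   would vanish on the standard basis. *)
have full : (line_space L + <[vec3 x y z]> = fullv)%VS.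
  apply/eqP; rewrite eqEdim subvf dimvf /dim /= mul1n.
  by have := dim_addv_line pL; rewrite (eqP (line_dim L)).
have eq_all x' y' z' : u * x' + v * y' + w * z' = 0.
  have : vec3 x' y' z' \in (line_space L + <[vec3 x y z]>)%VS.
    by rewrite full memvf.
  case/memv_addP=> l; have [x0 [y0 [z0 ->]]] := vec3_eta l => lL.
  case=> q /vlineP[c ->]; rewrite vec3Z vec3D => /vec3_inj[-> -> ->].
  transitivity ((u * x0 + v * y0 + w * z0) + c * (u * x + v * y + w * z)).
    by ring.
  by rewrite eqL // p0 mulr0 addr0.
have:= (eq_all 1 0 0, eq_all 0 1 0, eq_all 0 0 1).
by rewrite vec3_eq0 !mulr0 !mulr1 !addr0 !add0r => -[[-> ->] ->]; rewrite eqxx.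
Qed.

(** * Join and meet as cross products *)

Lemma join_equation (K : fieldType) (L : proj_line K) (P Q : proj_point K)
    (x y z x' y' z' : K) :
  P <> Q -> incident P L -> incident Q L ->
  has_coords P x y z -> has_coords Q x' y' z' ->
  has_equation L (y * z' - z * y') (z * x' - x * z') (x * y' - y * x').
Proof.
move=> neqPQ PL QL hP hQ.
have nz_p := has_coords_neq0 hP; have nz_q := has_coords_neq0 hQ.
have not_prop : vec3 x' y' z' \notin <[vec3 x y z]>%VS.
  apply/negP=> q_p; apply: neqPQ; apply: proj_point_ext.
  by rewrite hQ; apply: (has_coords_line hP).
split.
  apply: contra not_prop; rewrite vec3_eq0 => /and3P[/eqP e1 /eqP e2 /eqP e3].
  by apply/vlineP/cross_eq0_proportional.
have spanL : line_space L = (<[vec3 x y z]> + <[vec3 x' y' z']>)%VS.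
  apply/esym/eqP; rewrite eqEdim subv_add -!memvE (eqP (line_dim L)).
  rewrite -(incident_coords _ hP) -(incident_coords _ hQ) PL QL /=.
  by have := dim_addv_line not_prop; rewrite dim_vline nz_p.
move=> x0 y0 z0; rewrite spanL => /memv_addP[p /vlineP[c ->]].
case=> q /vlineP[d ->]; rewrite !vec3Z vec3D => /vec3_inj[-> -> ->].
(* A determinant with two equal rows vanishes. *)
by ring.
Qed.

(** Any coordinates of [P] are orthogonal to both normal vectors, which makes the cross product of
    the normals a multiple of them. It is nonzero, as proportional equations would define the same
    line. *)
Lemma meet_coords (K : fieldType) (L M : proj_line K) (P : proj_point K)
    (u v w u' v' w' : K) :
  L <> M -> incident P L -> incident P M ->
  has_equation L u v w -> has_equation M u' v' w' ->
  has_coords P (v * w' - w * v') (w * u' - u * w') (u * v' - v * u').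
Proof.
move=> neqLM PL PM eqL eqM; have [x [y [z hP]]] := proj_point_coords P.
move: PL PM; rewrite !(incident_coords _ hP).
rewrite (mem_line_equation _ _ _ eqL) (mem_line_equation _ _ _ eqM).
move=> /eqP pL /eqP pM; apply: (has_coords_line hP).
  apply/vlineP; apply: cross_eq0_proportional (has_coords_neq0 hP) _ _ _.
  (* Entries of the triple product p x (n x n') = (p.n') n - (p.n) n'. *)
  - transitivity (u * (u' * x + v' * y + w' * z) - u' * (u * x + v * y + w * z)).
      by ring.
    by rewrite pL pM !mulr0 subr0.
  - transitivity (v * (u' * x + v' * y + w' * z) - v' * (u * x + v * y + w * z)).
      by ring.
    by rewrite pL pM !mulr0 subr0.
  - transitivity (w * (u' * x + v' * y + w' * z) - w' * (u * x + v * y + w * z)).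
      by ring.
    by rewrite pL pM !mulr0 subr0.
apply/negP; rewrite vec3_eq0 => /and3P[/eqP e1 /eqP e2 /eqP e3].
have [c] := cross_eq0_proportional eqL.1 e1 e2 e3.
rewrite vec3Z => /vec3_inj[def_u' def_v' def_w'].
have nz_c : c != 0.
  apply/negP=> /eqP c0; case: eqM; rewrite def_u' def_v' def_w'.
  by rewrite -vec3Z c0 scale0r eqxx.
apply: neqLM; apply: proj_line_ext; apply/vspaceP=> p.
have [x0 [y0 [z0 ->]]] := vec3_eta p.
rewrite (mem_line_equation _ _ _ eqL) (mem_line_equation _ _ _ eqM).
rewrite def_u' def_v' def_w' -!mulrA -!mulrDr.
by rewrite mulf_eq0 (negPf nz_c).
Qed.

(** * Lines and triple points of a configuration, with conditions on indices that evaluate *)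

Lemma set3_zero_triples (n : nat) (i j k : 'Z_n) :
  uniq [:: i; j; k] -> i + j + k == 0 -> [set i; j; k] \in zero_triples n.
Proof.
move=> uniq_s sum0.
have def_s : [set i; j; k] = [set:: [:: i; j; k]].
  by apply/setP=> x; rewrite !inE orbA.
rewrite inE def_s cardsE (card_uniqP uniq_s) /=.
rewrite (eq_bigl (mem [:: i; j; k])) => [|x]; last by rewrite inE.
by rewrite -big_uniq //= !big_cons big_nil addr0 addrA sum0.
Qed.

(** All conditions on indices form one boolean on lists, which evaluates for concrete indices. Its
    last conjunct separates the two triples, hence the two points. The factor [c] is the common
    divisor removed from the cross product. *)
Lemma Boroczky_line (n : nat) (K : fieldType)
    (L : 'Z_n -> proj_line K) (P : {set 'Z_n} -> proj_point K)
    (l i j k i' j' k' : 'Z_n) (x y z x' y' z' c u v w : K) :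
  Boroczky_config L P ->
  has_coords (P [set i; j; k]) x y z ->
  has_coords (P [set i'; j'; k']) x' y' z' ->
  [&& uniq [:: i; j; k], uniq [:: i'; j'; k'],
      i + j + k == 0, i' + j' + k' == 0,
      l \in [:: i; j; k], l \in [:: i'; j'; k']
      & ~~ all (mem [:: i'; j'; k']) [:: i; j; k]] ->
  y * z' - z * y' = c * u -> z * x' - x * z' = c * v ->
  x * y' - y * x' = c * w ->
  has_equation (L l) u v w.
Proof.
move=> hB hI hJ /and5P[uI uJ sI sJ /and3P[lI lJ /negP neqIJ]] e1 e2 e3.
have zI := set3_zero_triples uI sI; have zJ := set3_zero_triples uJ sJ.
apply: (@has_equationZ _ _ c); rewrite -e1 -e2 -e3.
apply: (join_equation _ _ _ hI hJ).
- move=> /(Boroczky_points_distinct hB zI zJ) eqIJ; apply: neqIJ.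
  apply/allP=> m mI; have : m \in [set i; j; k] by move: mI; rewrite !inE orbA.
  by rewrite eqIJ !inE orbA.
- by apply: (Boroczky_incidence hB) zI _; move: lI; rewrite !inE orbA.
- by apply: (Boroczky_incidence hB) zJ _; move: lJ; rewrite !inE orbA.
Qed.

Lemma Boroczky_point (n : nat) (K : fieldType)
    (L : 'Z_n -> proj_line K) (P : {set 'Z_n} -> proj_point K)
    (i j k l m : 'Z_n) (x y z c u v w u' v' w' : K) :
  Boroczky_config L P ->
  has_equation (L l) u v w -> has_equation (L m) u' v' w' ->
  [&& uniq [:: i; j; k], i + j + k == 0,
      l \in [:: i; j; k], m \in [:: i; j; k] & l != m] ->
  v * w' - w * v' = c * x -> w * u' - u * w' = c * y ->
  u * v' - v * u' = c * z ->
  has_coords (P [set i; j; k]) x y z.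
Proof.
move=> hB hl hm /and5P[uI sI lI mI /eqP neq_lm] e1 e2 e3.
have zI := set3_zero_triples uI sI.
apply: (@has_coordsZ _ _ c); rewrite -e1 -e2 -e3.
apply: (meet_coords _ _ _ hl hm).
- by move=> /(Boroczky_lines_distinct hB).
- by apply: (Boroczky_incidence hB) zI _; move: lI; rewrite !inE orbA.
- by apply: (Boroczky_incidence hB) zI _; move: mI; rewrite !inE orbA.
Qed.

(** * Elimination for n = 24, over an arbitrary field *)

Lemma Boroczky24_relation (K : fieldType)
  (L : 'Z_24 -> proj_line K) (P : {set 'Z_24} -> proj_point K) (a b : K)
  (hB : Boroczky_config L P)
  (h1 : has_coords (P [set 0; 5; 19]) 1 0 0)
  (h2 : has_coords (P [set 3; 8; 13]) 0 1 0)
  (h3 : has_coords (P [set 11; 16; 21]) 0 0 1)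
  (h4 : has_coords (P [set 0; 8; 16]) 1 1 1)
  (h5 : has_coords (P [set 0; 3; 21]) a 1 1)
  (h6 : has_coords (P [set 0; 10; 14]) b 1 1)
  (ha : a != 0) :
  a ^+ 8 * b ^+ 3 + a ^+ 7 * b ^+ 3 + a ^+ 6 * b ^+ 4 - 6 * a ^+ 7 * b ^+ 2
  + 3 * a ^+ 6 * b ^+ 3 - 6 * a ^+ 6 * b ^+ 2 - 2 * a ^+ 5 * b ^+ 3
  + 10 * a ^+ 6 * b - 6 * a ^+ 5 * b ^+ 2 - 2 * a ^+ 4 * b ^+ 3 - a ^+ 6
  + 12 * a ^+ 5 * b + 3 * a ^+ 4 * b ^+ 2 - 2 * a ^+ 3 * b ^+ 3 - 6 * a ^+ 5
  + 3 * a ^+ 4 * b + 6 * a ^+ 3 * b ^+ 2 - a ^+ 2 * b ^+ 3 - 3 * a ^+ 4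
  - 13 * a ^+ 3 * b + 9 * a ^+ 2 * b ^+ 2 - a * b ^+ 3
  + 4 * a ^+ 3 - 12 * a ^+ 2 * b + 6 * a * b ^+ 2 - b ^+ 3 + 5 * a ^+ 2
  - 3 * a * b + 2 * a - b = 0.
Proof.
(* The first five lines each join two of the given points. In each call [//] evaluates the index
   condition and [ring] checks the three entries of the cross product. *)
have l_0 : has_equation (L 0) 0 (- 1) 1.
  by apply: (Boroczky_line hB (c := 1) h1 h4) => [//|||]; ring.
have l_3 : has_equation (L 3) 1 0 (- a).
  by apply: (Boroczky_line hB (c := 1) h2 h5) => [//|||]; ring.
have l_8 : has_equation (L 8) 1 0 (- 1).
  by apply: (Boroczky_line hB (c := 1) h2 h4) => [//|||]; ring.
have l_16 : has_equation (L 16) (- 1) 1 0.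
  by apply: (Boroczky_line hB (c := 1) h3 h4) => [//|||]; ring.
have l_21 : has_equation (L 21) (- 1) a 0.
  by apply: (Boroczky_line hB (c := 1) h3 h5) => [//|||]; ring.
(* The next four lines involve only a. Up to sign, the formulas respect a symmetry: exchanging the
   last two coordinates turns L_k into L_{-k}, and (x, y, z) -> (z, x, y) turns L_k into L_{k+8}. *)
have p_3_5_16 : has_coords (P [set 3; 5; 16]) a a 1.
  by apply: (Boroczky_point hB (c := 1) l_3 l_16) => [//|||]; ring.
have l_5 : has_equation (L 5) 0 (- 1) a.
  by apply: (Boroczky_line hB (c := 1) h1 p_3_5_16) => [//|||]; ring.
have p_8_19_21 : has_coords (P [set 8; 19; 21]) a 1 a.
  by apply: (Boroczky_point hB (c := 1) l_8 l_21) => [//|||]; ring.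
have l_19 : has_equation (L 19) 0 (- a) 1.
  by apply: (Boroczky_line hB (c := 1) h1 p_8_19_21) => [//|||]; ring.
have p_5_8_11 : has_coords (P [set 5; 8; 11]) 1 a 1.
  by apply: (Boroczky_point hB (c := 1) l_5 l_8) => [//|||]; ring.
have l_11 : has_equation (L 11) (- a) 1 0.
  by apply: (Boroczky_line hB (c := 1) h3 p_5_8_11) => [//|||]; ring.
have p_13_16_19 : has_coords (P [set 13; 16; 19]) 1 1 a.
  by apply: (Boroczky_point hB (c := 1) l_16 l_19) => [//|||]; ring.
have l_13 : has_equation (L 13) a 0 (- 1).
  by apply: (Boroczky_line hB (c := 1) h2 p_13_16_19) => [//|||]; ring.
(* The parameter b enters here, through the given point (b:1:1) on L_10 and L_14. *)
have p_3_10_11 : has_coords (P [set 3; 10; 11]) a (a ^+ 2) 1.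
  by apply: (Boroczky_point hB (c := 1) l_3 l_11) => [//|||]; ring.
have l_10 : has_equation (L 10) (- a ^+ 2 + 1) (a - b) (a ^+ 2 * b - a).
  by apply: (Boroczky_line hB (c := 1) h6 p_3_10_11) => [//|||]; ring.
have p_13_14_21 : has_coords (P [set 13; 14; 21]) a 1 (a ^+ 2).
  by apply: (Boroczky_point hB (c := 1) l_13 l_21) => [//|||]; ring.
have l_14 : has_equation (L 14) (a ^+ 2 - 1) (- a ^+ 2 * b + a) (- a + b).
  by apply: (Boroczky_line hB (c := 1) h6 p_13_14_21) => [//|||]; ring.
have p_5_6_13 : has_coords (P [set 5; 6; 13]) 1 (a ^+ 2) a.
  by apply: (Boroczky_point hB (c := 1) l_5 l_13) => [//|||]; ring.
have p_6_8_10 : has_coords (P [set 6; 8; 10])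
    (a - b)
    (- a ^+ 2 * b + a ^+ 2 + a - 1)
    (a - b).
  by apply: (Boroczky_point hB (c := 1) l_8 l_10) => [//|||]; ring.
(* L_6, and L_2 below, are L_10 and L_14 with the outer coordinates exchanged, in accordance with k
   -> 16 - k. *)
have l_6 : has_equation (L 6) (a ^+ 2 * b - a) (a - b) (- a ^+ 2 + 1).
  by apply: (Boroczky_line hB (c := a - 1) p_5_6_13 p_6_8_10) => [//|||]; ring.
have p_2_3_19 : has_coords (P [set 2; 3; 19]) (a ^+ 2) 1 a.
  by apply: (Boroczky_point hB (c := - 1) l_3 l_19) => [//|||]; ring.
have p_2_6_16 : has_coords (P [set 2; 6; 16]) 1 1 b.
  by apply: (Boroczky_point hB (c := a ^+ 2 - 1) l_6 l_16) => [//|||]; ring.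
have l_2 : has_equation (L 2) (- a + b) (- a ^+ 2 * b + a) (a ^+ 2 - 1).
  by apply: (Boroczky_line hB (c := 1) p_2_3_19 p_2_6_16) => [//|||]; ring.
have p_1_10_13 : has_coords (P [set 1; 10; 13])
    (a - b)
    (- a ^+ 3 * b + 2 * a ^+ 2 - 1)
    (a ^+ 2 - a * b).
  by apply: (Boroczky_point hB (c := - 1) l_10 l_13) => [//|||]; ring.
have p_1_2_21 : has_coords (P [set 1; 2; 21])
    (a ^+ 2 + a)
    (a + 1)
    (a * b + a).
  by apply: (Boroczky_point hB (c := - a + 1) l_2 l_21) => [//|||]; ring.
have l_1 : has_equation (L 1)
    (- a ^+ 4 * b ^+ 2 - a ^+ 4 * b + 2 * a ^+ 3 * b + a ^+ 3 + a ^+ 2 * b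
      - a ^+ 2 - a)
    (a ^+ 4 - a ^+ 3 * b + a ^+ 3 - 2 * a ^+ 2 * b + a * b ^+ 2 - a ^+ 2
      + a * b)
    (a ^+ 5 * b + a ^+ 4 * b - 2 * a ^+ 4 - 2 * a ^+ 3 + 2 * a ^+ 2 - a * b
      + 2 * a - b).
  by apply: (Boroczky_line hB (c := 1) p_1_10_13 p_1_2_21) => [//|||]; ring.
have p_6_7_11 : has_coords (P [set 6; 7; 11])
    (a + 1)
    (a ^+ 2 + a)
    (a * b + a).
  by apply: (Boroczky_point hB (c := a - 1) l_6 l_11) => [//|||]; ring.
have p_3_7_14 : has_coords (P [set 3; 7; 14])
    (a ^+ 3 * b - a ^+ 2)
    (a ^+ 3 - 2 * a + b)
    (a ^+ 2 * b - a).
  by apply: (Boroczky_point hB (c := - 1) l_3 l_14) => [//|||]; ring.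
(* By the same symmetry L_7 is L_1 with the first two coordinates exchanged, up to sign (k -> 8 -
   k), and L_9 is L_1 shifted cyclically (k -> k + 8). *)
have l_7 : has_equation (L 7)
    (- a ^+ 4 + a ^+ 3 * b - a ^+ 3 + 2 * a ^+ 2 * b - a * b ^+ 2 + a ^+ 2
      - a * b)
    (a ^+ 4 * b ^+ 2 + a ^+ 4 * b - 2 * a ^+ 3 * b - a ^+ 3 - a ^+ 2 * b
      + a ^+ 2 + a)
    (- a ^+ 5 * b - a ^+ 4 * b + 2 * a ^+ 4 + 2 * a ^+ 3 - 2 * a ^+ 2
      + a * b - 2 * a + b).
  by apply: (Boroczky_line hB (c := 1) p_6_7_11 p_3_7_14) => [//|||]; ring.
have p_5_9_10 : has_coords (P [set 5; 9; 10])
    (a * b + a)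
    (a ^+ 2 + a)
    (a + 1).
  by apply: (Boroczky_point hB (c := - a + 1) l_5 l_10) => [//|||]; ring.
have p_2_9_13 : has_coords (P [set 2; 9; 13])
    (a ^+ 2 * b - a)
    (a ^+ 3 - 2 * a + b)
    (a ^+ 3 * b - a ^+ 2).
  by apply: (Boroczky_point hB (c := 1) l_2 l_13) => [//|||]; ring.
have l_9 : has_equation (L 9)
    (a ^+ 5 * b + a ^+ 4 * b - 2 * a ^+ 4 - 2 * a ^+ 3 + 2 * a ^+ 2 - a * b
      + 2 * a - b)
    (- a ^+ 4 * b ^+ 2 - a ^+ 4 * b + 2 * a ^+ 3 * b + a ^+ 3 + a ^+ 2 * b
      - a ^+ 2 - a)
    (a ^+ 4 - a ^+ 3 * b + a ^+ 3 - 2 * a ^+ 2 * b + a * b ^+ 2 - a ^+ 2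
      + a * b).
  by apply: (Boroczky_line hB (c := 1) p_5_9_10 p_2_9_13) => [//|||]; ring.
have p_7_20_21 : has_coords (P [set 7; 20; 21])
    (a ^+ 4 * b + a ^+ 3 * b - 2 * a ^+ 3 + a ^+ 2 * b - 2 * a ^+ 2 + a * b)
    (a ^+ 3 * b + a ^+ 2 * b - 2 * a ^+ 2 + a * b - 2 * a + b)
    (a ^+ 2 * b ^+ 2 - a ^+ 3 + 2 * a ^+ 2 * b - a ^+ 2 - a).
  by apply: (Boroczky_point hB (c := a ^+ 2 - 1) l_7 l_21) => [//|||]; ring.
have p_9_19_20 : has_coords (P [set 9; 19; 20])
    (a ^+ 2 * b ^+ 2 - a ^+ 3 + 2 * a ^+ 2 * b - a ^+ 2 - a)
    (a ^+ 3 * b + a ^+ 2 * b - 2 * a ^+ 2 + a * b - 2 * a + b)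
    (a ^+ 4 * b + a ^+ 3 * b - 2 * a ^+ 3 + a ^+ 2 * b - 2 * a ^+ 2
      + a * b).
  by apply: (Boroczky_point hB (c := - a ^+ 2 + 1) l_9 l_19) => [//|||]; ring.
(* The two points are (X:Y:Z) and (Z:Y:X), because k -> 16 - k fixes 20. Their cross product is X -
   Z times (Y, -(X + Z), Y), and [c] is X - Z. *)
have l_20 : has_equation (L 20)
    (a ^+ 3 * b + a ^+ 2 * b - 2 * a ^+ 2 + a * b - 2 * a + b)
    (- a ^+ 4 * b - a ^+ 3 * b - a ^+ 2 * b ^+ 2 + 3 * a ^+ 3
      - 3 * a ^+ 2 * b + 3 * a ^+ 2 - a * b + a)
    (a ^+ 3 * b + a ^+ 2 * b - 2 * a ^+ 2 + a * b - 2 * a + b).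
  by apply: (Boroczky_line hB (c :=
    a ^+ 4 * b + a ^+ 3 * b - a ^+ 2 * b ^+ 2 - a ^+ 3 - a ^+ 2 * b - a ^+ 2
      + a * b + a)
    p_7_20_21 p_9_19_20) => [//|||]; ring.
have p_1_3_20 : has_coords (P [set 1; 3; 20])
    (a ^+ 5 * b + a ^+ 4 * b + a ^+ 3 * b ^+ 2 - 3 * a ^+ 4 + 3 * a ^+ 3 * b
      - 3 * a ^+ 3 + a ^+ 2 * b - a ^+ 2)
    (a ^+ 4 * b + 2 * a ^+ 3 * b - 2 * a ^+ 3 + 2 * a ^+ 2 * b - 4 * a ^+ 2
      + 2 * a * b - 2 * a + b)
    (a ^+ 4 * b + a ^+ 3 * b + a ^+ 2 * b ^+ 2 - 3 * a ^+ 3 + 3 * a ^+ 2 * b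
      - 3 * a ^+ 2 + a * b - a).
  by apply: (Boroczky_point hB (c := - 1) l_3 l_20) => [//|||]; ring.
have zI : [set 1; 3; 20] \in zero_triples 24 by apply: set3_zero_triples.
have : incident (P [set 1; 3; 20]) (L 1).
  by apply: (Boroczky_incidence hB) zI _; rewrite !inE eqxx.
rewrite (incident_coords _ p_1_3_20) => /l_1.2 det0.
(* The equation of L_1 evaluated at P_{1,3,20} is -a times the polynomial, hence the change of
   sign. *)
by apply: (mulfI ha); rewrite mulr0 -[RHS]oppr0 -[in RHS]det0; ring.
Qed.

Theorem mainTheorem9 (R : realType)
  (L : 'Z_24 -> proj_line R[i]) (P : {set 'Z_24} -> proj_point R[i]) (a b : R[i])
  (hB : Boroczky_config L P)
  (h1 : has_coords (P [set 0; 5; 19]) 1 0 0)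
  (h2 : has_coords (P [set 3; 8; 13]) 0 1 0)
  (h3 : has_coords (P [set 11; 16; 21]) 0 0 1)
  (h4 : has_coords (P [set 0; 8; 16]) 1 1 1)
  (h5 : has_coords (P [set 0; 3; 21]) a 1 1)
  (h6 : has_coords (P [set 0; 10; 14]) b 1 1)
  (ha : a != 0) :
  a ^+ 8 * b ^+ 3 + a ^+ 7 * b ^+ 3 + a ^+ 6 * b ^+ 4 - 6 * a ^+ 7 * b ^+ 2
  + 3 * a ^+ 6 * b ^+ 3 - 6 * a ^+ 6 * b ^+ 2 - 2 * a ^+ 5 * b ^+ 3
  + 10 * a ^+ 6 * b - 6 * a ^+ 5 * b ^+ 2 - 2 * a ^+ 4 * b ^+ 3 - a ^+ 6
  + 12 * a ^+ 5 * b + 3 * a ^+ 4 * b ^+ 2 - 2 * a ^+ 3 * b ^+ 3 - 6 * a ^+ 5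
  + 3 * a ^+ 4 * b + 6 * a ^+ 3 * b ^+ 2 - a ^+ 2 * b ^+ 3 - 3 * a ^+ 4
  - 13 * a ^+ 3 * b + 9 * a ^+ 2 * b ^+ 2 - a * b ^+ 3
  + 4 * a ^+ 3 - 12 * a ^+ 2 * b + 6 * a * b ^+ 2 - b ^+ 3 + 5 * a ^+ 2
  - 3 * a * b + 2 * a - b = 0.
Proof. exact: Boroczky24_relation hB h1 h2 h3 h4 h5 h6 ha. Qed.
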